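(* Let $d\geq 1$ be an integer and let $Q$ be a finite (left) quasifield with $q$ elements whose kernel is $K$. If $A\subset Q$ and $|A| > q^{\frac12 + \frac1d}(|K|-1)^{-1/(2d)}$, then \[ Q\setminus\{0\} \subset \underbrace{A\cdot A + \cdots + A\cdot A}_{d\ \text{terms}}, \] i.e., every nonzero element of $Q$ can be written as $a_1\cdot a_1' + \cdots + a_d\cdot a_d'$ with all $a_i,a_i'\in A$.
   Context: A (left) quasifield is a set $Q$ with two binary operations $+$ and $\cdot$ such that $(Q,+)$ is a group with identity $0$; $(Q\setminus\{0\},\cdot)$ is a loop (for all $a,b$ the equations $a\cdot x=b$ and $y\cdot a=b$ have unique solutions, and there is an identity $1$); $a\cdot(b+c)=a\cdot b+a\cdot c$ for all $a,b,c$; $0\cdot x=0$ for all $x$; and for $a\neq b$ the equation $a\cdot x=b\cdot x+c$ has exactly one solution $x$. The kernel $K$ of $Q$ is the set of all $k\in Q$ such that $(x+y)\cdot k = x\cdot k + y\cdot k$ and $(x\cdot y)\cdot k = x\cdot(y\cdot k)$ for all $x,y\in Q$. *)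

(* Defs.v *)
From mathcomp Require Import all_boot.

Set Implicit Arguments.
Unset Strict Implicit.
Unset Printing Implicit Defensive.

Definition is_group (T : Type) (op : T -> T -> T) (e : T) : Prop :=
  [/\ associative op, left_id e op, right_id e op
    & forall x, exists y, op y x = e /\ op x y = e].

(* [op] restricts to a loop on the subset of [T] cut out by [P]. *)
Record is_loop_on (T : Type) (P : T -> Prop) (op : T -> T -> T) : Prop := {
  loop_closed : forall a b, P a -> P b -> P (op a b);
  loop_ldiv : forall a b, P a -> P b -> exists! x, P x /\ op a x = b;
  loop_rdiv : forall a b, P a -> P b -> exists! y, P y /\ op y a = b;
  loop_id : exists e, P e /\ forall a, P a -> op e a = a /\ op a e = a
}.

(* Neither commutativity of [add] nor associativity of [mul] is assumed. *)
Record is_left_quasifield (Q : Type) (add mul : Q -> Q -> Q) (zero : Q) :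
    Prop := {
  quasifield_add : is_group add zero;
  quasifield_mul : is_loop_on (fun x => x <> zero) mul;
  quasifield_mulDr : forall a b c, mul a (add b c) = add (mul a b) (mul a c);
  quasifield_mul0 : forall x, mul zero x = zero;
  quasifield_eqn : forall a b c, a <> b ->
    exists! x, mul a x = add (mul b x) c
}.

Definition qkernel (Q : finType) (add mul : Q -> Q -> Q) : {set Q} :=
  [set k | [forall x, forall y,
      (mul (add x y) k == add (mul x k) (mul y k))
      && (mul (mul x y) k == mul x (mul y k))]].

(* Main.v *)
(* Consider the bipartite graph between Q^d and Q^d x Q with u ~ (w, t) when
   u . w = t: any u has q^d neighbours and two distinct u have q^(d-1) common
   ones, because a y = b y + c has one solution y when a <> b.  Hence the degree
   into S = A^d, over the q^(d+1) points (w, t), has mean |S|/q and its squared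
   deviations sum to at most q^d |S|.  If u . v = x has no solution with u and v
   in S, the (|K|-1) |S| points (v k, x k) with v in S and k in K \ {0} all have
   degree 0, so (|K|-1) |S|^2 <= q^(d+2), which contradicts the size of A.
     Counting common neighbours needs (Q, +) to be abelian: the maps y |-> c y
   with c <> 0 are automorphisms of (Q, +) and act transitively on Q \ {0}. *)
From HB Require Import structures.
Require Import Defs.
From mathcomp Require Import all_boot all_order all_algebra all_fingroup.
From mathcomp Require Import all_classical all_reals all_analysis.
From mathcomp Require Import ring lra.

Set Implicit Arguments.
Unset Strict Implicit.
Unset Printing Implicit Defensive.

Import Order.TTheory GRing.Theory Num.Theory.

Local Open Scope ring_scope.

(** * Commutativity of the addition *)

(** [f] carries the centraliser of [x] injectively into that of [f x]. *)
Lemma leq_card_cent1_morph (gT : finGroupType) (f : gT -> gT) (x : gT) :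
    injective f -> {morph f : a b / (a * b)%g} ->
  (#|'C[x]%g| <= #|'C[f x]%g|)%N.
Proof.
move=> f_inj fM; rewrite -(card_imset _ f_inj).
apply/subset_leq_card/fintype.subsetP => _ /imsetP[a /cent1P xa ->].
by apply/cent1P; rewrite /commute -!fM xa.
Qed.

(* All nontrivial conjugacy classes have the same size m, and m divides both
   #|G| and #|G| - 1. *)
Lemma transitive_endo_commute (gT : finGroupType) :
    (forall x y : gT, x != 1%g -> y != 1%g ->
       exists2 f : gT -> gT, injective f /\ {morph f : a b / (a * b)%g}
                             & f x = y) ->
  forall x y : gT, commute x y.
Proof.
move=> tr x y; have [->|x1] := eqVneq x 1%g; first exact: commute_sym (commute1 y).
suff Cx : 'C[x]%g = [set: gT].
  by apply/cent1P; rewrite cent1C Cx inE.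
have Cle (a b : gT) : a != 1%g -> b != 1%g -> (#|'C[a]%g| <= #|'C[b]%g|)%N.
  by move=> a1 b1; have [f [fi fM] <-] := tr _ _ a1 b1; apply: leq_card_cent1_morph.
have Ceq (z : gT) : z != 1%g -> #|'C[z]%g| = #|'C[x]%g|.
  by move=> z1; apply/eqP; rewrite eqn_leq !Cle.
pose G := [set: gT]%G; pose m := #|(x ^: G)%g|.
have CM (z : gT) : (#|'C[z]%g| * #|(z ^: G)%g|)%N = #|G|.
  by rewrite -[RHS](Lagrange (subsetIl G 'C[z]%g)) index_cent1 /= finset.setTI.
have dvd_mG : (m %| #|G|)%N by rewrite -(CM x) dvdn_mull.
have dvd_m : (m %| \sum_(C in classes G | C != 1%g) #|C|)%N.
  apply: dvdn_sum => C /andP[/imsetP[z _ ->] zG1].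
  have z1 : z != 1%g by apply: contra zG1 => /eqP->; rewrite class1G.
  have /eqP := CM z; rewrite -(CM x) (Ceq z z1).
  by rewrite eqn_pmul2l ?cardG_gt0 // => /eqP->.
have m1 : m = 1%N.
  apply/eqP; rewrite -dvdn1 -(dvdn_addl 1 dvd_m).
  by move: dvd_mG; rewrite -sum_card_class (bigD1 1%g) ?classes1 //= cards1.
by apply/eqP; rewrite eqEcard finset.subsetT /= -(CM x) -/m m1 muln1.
Qed.

(** [is_group] gives inverses only existentially, while the group structure needs a function. The
    default [e] is never reached when [op] is a group law. *)
Definition group_opp (Q : finType) (op : Q -> Q -> Q) (e x : Q) : Q :=
  odflt e [pick y | op y x == e].

Lemma group_oppP (Q : finType) (op : Q -> Q -> Q) (e : Q) :
  is_group op e -> left_inverse e (group_opp op e) op.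
Proof.
case=> _ _ _ opN x; rewrite /group_opp; case: pickP => [y /eqP//|no].
by have [y [yx _]] := opN x; have := no y; rewrite yx eqxx.
Qed.

(** A copy of [Q] indexed by the proof of the group axioms, so that a [finGroupType] structure can
    be attached to it for an arbitrary [op]. *)
Definition group_carrier (Q : finType) (op : Q -> Q -> Q) (e : Q)
  (_ : is_group op e) : Type := Q.

HB.instance Definition _ (Q : finType) (op : Q -> Q -> Q) (e : Q)
    (H : is_group op e) :=
  Finite.copy (group_carrier H) Q.

HB.instance Definition _ (Q : finType) (op : Q -> Q -> Q) (e : Q)
    (H : is_group op e) :=
  Finite_isGroup.Build (group_carrier H)
    (let: And4 opA _ _ _ := H in opA) (let: And4 _ op1 _ _ := H in op1)
    (group_oppP H).

Lemma quasifield_addC (Q : finType) (add mul : Q -> Q -> Q) (zero : Q) :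
  is_left_quasifield add mul zero -> commutative add.
Proof.
case=> H [mulP ldiv rdiv _] mulDr _ _; have [addA add0 addr0 _] := H.
pose gT : finGroupType := group_carrier H.
apply: (@transitive_endo_commute gT) => x y /eqP x0 /eqP y0.
have [c [[c0 cx] _]] := rdiv x y x0 y0.
exists (mul c) => //; split=> [a b|a b]; last exact: mulDr.
have mul_c0 : mul c zero = zero.
  by apply: (@mulgI gT (mul c zero)); rewrite mulg1 -[LHS]mulDr add0.
(* The loop axioms concern nonzero elements only, so zero arguments are treated apart: a product of
   nonzero elements is never zero. *)
have [->|/eqP a0] := eqVneq (a : Q) zero;
  have [->|/eqP b0] := eqVneq (b : Q) zero => //.
- by rewrite mul_c0 => /esym /(mulP _ _ c0 b0).
- by rewrite mul_c0 => /(mulP _ _ c0 a0).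
- move=> cab; have [z [_ zu]] := ldiv c (mul c b) c0 (mulP _ _ c0 b0).
  by rewrite -(zu a) // -(zu b).
Qed.

(** * Variance bound in a bipartite graph *)

(* The q-scaled deviations q * D v - #|S| from the mean degree have small
   variance, while each v in T contributes #|S|^2 to it. *)
Lemma no_edge_bound (U V : finType) (r : U -> V -> bool) (S : {set U})
    (T : {set V}) (q k m : nat) :
    (forall u, #|[set v | r u v]| = k) ->
    (forall u u', u != u' -> (#|[set v | r u v && r u' v]| <= m)%N) ->
    (q * m = k)%N -> (#|V| = q * k)%N ->
    (forall u v, u \in S -> v \in T -> ~~ r u v) ->
  (#|T| * #|S| ^ 2 <= q ^ 2 * (k * #|S|))%N.
Proof.
move=> deg codeg qm cardV noST.
pose D v := \sum_(u in S) (r u v)%:Z.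
pose n := #|S|%:Z.
have sumD : \sum_v D v = n * k%:Z.
  rewrite exchange_big /= (eq_bigr (fun=> k%:Z)) => [|u _].
    by rewrite sumr_const -mulr_natl natz.
  rewrite -(deg u) -sum1_card -[RHS]natz natr_sum [RHS]big_mkcond /=.
  by apply: eq_bigr => v _; rewrite inE; case: (r u v).
(* The second moment counts common neighbours over ordered pairs in [S]: [k] on the diagonal, at
   most [m] off it. *)
have sumD2 : \sum_v D v ^+ 2 <= n * k%:Z + n ^+ 2 * m%:Z.
  have -> : \sum_v D v ^+ 2 =
      \sum_(u in S) \sum_(u' in S) #|[set v | r u v && r u' v]|%:Z.
    under eq_bigr => v _ do rewrite expr2 big_distrlr /=.
    rewrite exchange_big /=; apply: eq_bigr => u _.
    rewrite exchange_big /=; apply: eq_bigr => u' _.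
    rewrite -sum1_card -[RHS]natz natr_sum [RHS]big_mkcond /=.
    by apply: eq_bigr => v _; rewrite inE; case: (r u v); case: (r u' v).
  have -> : n * k%:Z + n ^+ 2 * m%:Z = \sum_(u in S) (k%:Z + n * m%:Z).
    by rewrite sumr_const -mulr_natl natz -/n; ring.
  apply: ler_sum => u uS; rewrite (bigD1 u uS) /=.
  apply: lerD.
    by rewrite -(deg u) (eq_card (B := [set v | r u v])) // => v; rewrite !inE andbb.
  (* Enlarging the n - 1 off-diagonal terms to [n] makes the quadratic terms in [n] cancel exactly
     at the end. *)
  apply: (@le_trans _ _ (\sum_(u' in S | u' != u) m%:Z)).
    by apply: ler_sum => u' /andP[_ uu']; rewrite lez_nat codeg // eq_sym.
  have -> : n * m%:Z = \sum_(u' in S) m%:Z.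
    by rewrite sumr_const -mulr_natl natz.
  by rewrite [leRHS](bigD1 u uS) /= lerDr.
have low : \sum_(v in T) n ^+ 2 <= \sum_v (q%:Z * D v - n) ^+ 2.
  rewrite big_mkcond; apply: ler_sum => v _.
  case: ifP => [vT|_]; last exact: sqr_ge0.
  rewrite /D big1 ?mulr0 ?sub0r ?sqrrN // => u uS.
  by rewrite (negbTE (noST u v uS vT)).
have exp : \sum_v (q%:Z * D v - n) ^+ 2 =
    q%:Z ^+ 2 * (\sum_v D v ^+ 2) - q%:Z * n *+ 2 * (\sum_v D v)
      + (q * k)%:Z * n ^+ 2.
  have -> : (q * k)%:Z * n ^+ 2 = \sum_(v : V) n ^+ 2.
    by rewrite sumr_const -cardV -mulr_natl natz.
  rewrite !mulr_sumr -sumrB -big_split /=.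
  by apply: eq_bigr => v _; ring.
have q2 : q%:Z ^+ 2 * (\sum_v D v ^+ 2) <= q%:Z ^+ 2 * (n * k%:Z + n ^+ 2 * m%:Z).
  by apply: ler_wpM2l; rewrite ?sqr_ge0.
move: low; rewrite exp sumD sumr_const -(mulr_natl (n ^+ 2)) natz => low.
rewrite -lez_nat !PoszM -!expr2 -/n.
apply: le_trans low _; rewrite !PoszM.
(* With q m = k, the multiples of q k n^2 have coefficients 1, -2 and 1, so only q^2 k n
   survives. *)
have {}q2 : q%:Z ^+ 2 * (\sum_v D v ^+ 2) <=
    q%:Z ^+ 2 * n * k%:Z + q%:Z * n ^+ 2 * k%:Z.
  apply: le_trans q2 _; rewrite -qm PoszM.
  by rewrite le_eqVlt; apply/orP; left; apply/eqP; ring.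
by lra.
Qed.

(** * Cancellation laws and the kernel *)

Lemma group_opI (T : Type) (op : T -> T -> T) (e : T) :
  is_group op e -> left_injective op.
Proof.
case=> opA _ opr1 opN z x y.
have [t [_ zt]] := opN z => /(congr1 (op^~ t)).
by rewrite -!opA zt !opr1.
Qed.

Lemma quasifield_mulr0 (Q : Type) (add mul : Q -> Q -> Q) (zero : Q) :
  is_left_quasifield add mul zero -> forall x, mul x zero = zero.
Proof.
case=> H _ mulDr _ _ x; have [[_ add0 _ _] addI] := (H, group_opI H).
by apply: (addI (mul x zero)); rewrite -mulDr !add0.
Qed.

Lemma quasifield_mulIr (Q : eqType) (add mul : Q -> Q -> Q) (zero : Q) :
  is_left_quasifield add mul zero ->
  forall k, k <> zero -> injective (mul^~ k).
Proof.
case=> _ [mulP _ rdiv _] _ mul0 _ k k0 a b /= ab.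
have [a0|/eqP a0] := eqVneq a zero; have [b0|/eqP b0] := eqVneq b zero.
- by rewrite a0 b0.
- by case: (mulP _ _ b0 k0); rewrite -ab a0 mul0.
- by case: (mulP _ _ a0 k0); rewrite ab b0 mul0.
have [y [_ yu]] := rdiv k (mul a k) k0 (mulP _ _ a0 k0).
by rewrite -(yu a) // -(yu b).
Qed.

Lemma quasifield_mulrI (Q : eqType) (add mul : Q -> Q -> Q) (zero : Q) :
  is_left_quasifield add mul zero ->
  forall x, x <> zero -> injective (mul x).
Proof.
move=> HQ x x0 a b /= ab; have mulr0 := quasifield_mulr0 HQ.
case: HQ => _ [mulP ldiv _ _] _ _ _.
have [a0|/eqP a0] := eqVneq a zero; have [b0|/eqP b0] := eqVneq b zero.
- by rewrite a0 b0.
- by case: (mulP _ _ x0 b0); rewrite -ab a0 mulr0.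
- by case: (mulP _ _ x0 a0); rewrite ab b0 mulr0.
have [y [_ yu]] := ldiv x (mul x a) x0 (mulP _ _ x0 a0).
by rewrite -(yu a) // -(yu b).
Qed.

Lemma qkernelP (Q : finType) (add mul : Q -> Q -> Q) (k : Q) :
  reflect ({morph mul^~ k : x y / add x y} /\
           forall x y, mul (mul x y) k = mul x (mul y k))
          (k \in qkernel add mul).
Proof.
rewrite inE; apply: (iffP forallP) => [H|[HD HA] x].
  by split=> x y; have /forallP/(_ y)/andP[/eqP ? /eqP ?] := H x.
by apply/forallP => y; rewrite HD HA !eqxx.
Qed.

Lemma zero_in_qkernel (Q : finType) (add mul : Q -> Q -> Q) (zero : Q) :
  is_left_quasifield add mul zero -> zero \in qkernel add mul.
Proof.
move=> HQ; have mulr0 := quasifield_mulr0 HQ.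
have [_ add0 _ _] := quasifield_add HQ.
by apply/qkernelP; split=> x y; rewrite !mulr0 ?add0.
Qed.

(** Both 0 and the loop identity lie in the kernel. This makes |K| - 1 positive, so that one can
    divide by it. *)
Lemma qkernel_gt1 (Q : finType) (add mul : Q -> Q -> Q) (zero : Q) :
  is_left_quasifield add mul zero -> (1 < #|qkernel add mul|)%N.
Proof.
move=> HQ; have [_ _ _ [one [one0 mul1]]] := quasifield_mul HQ.
have mulr1 x : mul x one = x.
  have [->|/eqP x0] := eqVneq x zero; first exact: quasifield_mul0 HQ one.
  by have [] := mul1 x x0.
rewrite (cardsD1 zero) zero_in_qkernel // ltnS card_gt0.
apply/set0Pn; exists one; rewrite !inE; apply/andP; split; first exact/eqP.
by apply/forallP => x; apply/forallP => y; rewrite !mulr1 !eqxx.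
Qed.

(** * Dot products and the counting inequality *)

Definition qdot (Q : finType) (add mul : Q -> Q -> Q) (zero : Q) (d : nat)
    (u w : {ffun 'I_d -> Q}) : Q :=
  \big[add/zero]_(i < d) mul (u i) (w i).

(** At a coordinate [i] where [u] and [u'] differ, [w i] is determined by the other coordinates of
    [w]. Hence overwriting coordinate [i] freely is injective on Q x E, which gives |Q| |E| <=
    |Q|^d. *)
Lemma card_qdot_eq (Q : finType) (add mul : Q -> Q -> Q) (zero : Q) (d : nat)
    (u u' : {ffun 'I_d -> Q}) :
    is_left_quasifield add mul zero -> u != u' ->
  (#|[set w | qdot add mul zero u w == qdot add mul zero u' w]|
     <= #|Q| ^ d.-1)%N.
Proof.
move=> HQ neq_uu'; have H := quasifield_add HQ.
have [addA _ addr0 addN] := H.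
(* Commutativity of [add] is what allows term [i] to be moved to the front of the sum in
   [split_dot]. *)
pose addM : SemiGroup.com_law Q :=
  HB.pack add (SemiGroup.isComLaw.Build Q add addA (quasifield_addC HQ)).
have [i ui] : exists i, u i != u' i.
  apply/existsP; apply: contraNT neq_uu' => /existsPn H'; apply/eqP/ffunP => i.
  by apply/eqP; have := H' i; rewrite negbK.
have Q_gt0 : (0 < #|Q|)%N by apply/card_gt0P; exists zero.
have d_gt0 : (0 < d)%N := leq_ltn_trans (leq0n i) (ltn_ord i).
set E := [set w | _].
have cardF : #|{: {ffun 'I_d -> Q}}| = (#|Q| ^ d)%N by rewrite card_ffun card_ord.
rewrite -(leq_pmul2l Q_gt0) -expnS prednK // -cardF -[#|Q|]cardsT -cardsX.
pose upd (xw : Q * {ffun 'I_d -> Q}) : {ffun 'I_d -> Q} :=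
  [ffun j => if j == i then xw.1 else xw.2 j].
suff upd_inj : {in finset.setX finset.setT E &, injective upd}.
  by rewrite -(card_in_imset upd_inj) max_card.
have split_dot v w : qdot add mul zero v w =
    add (mul (v i) (w i)) (\big[add/zero]_(j | j != i) mul (v j) (w j)).
  exact: (bigD1 (op := addM) i (F := fun j => mul (v j) (w j)) isT).
move=> [x w] [x' w'] /setXP[_ wE] /setXP[_ w'E] eq_upd.
have updE j : upd (x, w) j = upd (x', w') j by rewrite eq_upd.
have ww' j : j != i -> w j = w' j.
  by move=> ji; have := updE j; rewrite !ffunE (negbTE ji).
have {updE} -> : x = x' by have := updE i; rewrite !ffunE eqxx.
congr (_, _); apply/ffunP => j; have [->|] := eqVneq j i; last exact: ww'.
have rest v : \big[add/zero]_(j | j != i) mul (v j) (w' j) =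
              \big[add/zero]_(j | j != i) mul (v j) (w j).
  by apply: eq_bigr => l /ww'->.
move: wE w'E; rewrite !inE !split_dot !rest => /eqP wE /eqP w'E.
(* Adding the inverse [t] of the remaining sum for [u] on the right brings the equality to the form
   a y = b y + c. *)
have [t [_ st]] := addN (\big[add/zero]_(j | j != i) mul (u j) (w j)).
pose c := add (\big[add/zero]_(j | j != i) mul (u' j) (w j)) t.
have solve y : add (mul (u i) y) (\big[add/zero]_(j | j != i) mul (u j) (w j)) =
    add (mul (u' i) y) (\big[add/zero]_(j | j != i) mul (u' j) (w j)) ->
    mul (u i) y = add (mul (u' i) y) c.
  by move=> /(congr1 (add^~ t)); rewrite -!addA st addr0.
have [y [_ yu]] := quasifield_eqn HQ c (elimN eqP ui).
by rewrite -(yu _ (solve _ wE)) -(yu _ (solve _ w'E)).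
Qed.

Lemma missed_dot_product_bound (Q : finType) (add mul : Q -> Q -> Q)
    (zero : Q) (d : nat) (A : {set Q}) (x : Q) :
    is_left_quasifield add mul zero -> (0 < d)%N -> x <> zero ->
    (forall u v : {ffun 'I_d -> Q}, (forall i, u i \in A) ->
       (forall i, v i \in A) -> qdot add mul zero u v <> x) ->
  ((#|qkernel add mul| - 1) * #|A| ^ (2 * d) <= #|Q| ^ (d + 2))%N.
Proof.
move=> HQ d_gt0 x0 miss.
pose dot := @qdot Q add mul zero d.
pose r (u : {ffun 'I_d -> Q}) (v : {ffun 'I_d -> Q} * Q) := dot u v.1 == v.2.
pose S : {set {ffun 'I_d -> Q}} := [set u in ffun_on (mem A)].
have SP (u : {ffun 'I_d -> Q}) : reflect (forall i, u i \in A) (u \in S).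
  by rewrite inE; apply: ffun_onP.
have cardS : #|S| = (#|A| ^ d)%N by rewrite cardsE card_ffun_on card_ord.
pose scale (vk : {ffun 'I_d -> Q} * Q) : {ffun 'I_d -> Q} * Q :=
  ([ffun i => mul (vk.1 i) vk.2], mul x vk.2).
pose Ks := qkernel add mul :\ zero.
have cardKs : #|Ks| = (#|qkernel add mul| - 1)%N.
  by rewrite (cardsD1 zero (qkernel _ _)) zero_in_qkernel // add1n subn1.
pose T := scale @: finset.setX S Ks.
(* [scale] is injective here: x k determines k because x is nonzero, and then k cancels in each
   coordinate. *)
have cardT : #|T| = (#|Ks| * #|S|)%N.
  rewrite card_in_imset ?cardsX 1?mulnC // => -[v k] [v' k'].
  move=> /setXP[_ /setD1P[/eqP k0 _]] _ [vk /(quasifield_mulrI HQ x0) ek].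
  rewrite -ek in vk *; congr (_, _); apply/ffunP => i.
  by apply: (quasifield_mulIr HQ k0); have /ffunP/(_ i) := vk; rewrite !ffunE.
have deg u : #|[set v | r u v]| = (#|Q| ^ d)%N.
  have -> : [set v | r u v] = [set (w, dot u w) | w in [set: {ffun 'I_d -> Q}]].
    apply/setP => -[w t]; rewrite inE /r /=; apply/eqP/imsetP =>
      [<-|[w' _ [-> ->//]]].
    by exists w; rewrite ?inE.
  rewrite card_imset => [|w w' [->//]].
  by rewrite cardsT card_ffun card_ord.
(* A common neighbour [(w, t)] is determined by [w], on which both dot products agree. *)
have codeg u u' : u != u' -> (#|[set v | r u v && r u' v]| <= #|Q| ^ d.-1)%N.
  move=> uu'; apply: leq_trans (card_qdot_eq HQ uu').
  rewrite -(card_imset _ (can_inj (g := fst) (f := fun w => (w, dot u w)) _)) //.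
  apply/subset_leq_card/fintype.subsetP => -[w t].
  rewrite inE => /andP[/eqP/= ut /eqP/= u't].
  by apply/imsetP; exists w; rewrite ?inE ?ut // -/dot ut u't.
(* For k in the kernel, u . (w k) = (u . w) k; if this were x k, cancelling k would give u . w =
   x. *)
have noST u v : u \in S -> v \in T -> ~~ r u v.
  move=> /SP uA /imsetP[[w k] /setXP[/SP wA /setD1P[/eqP k0 /qkernelP[kD kA]]] ->].
  apply/eqP => /=; rewrite /dot /qdot.
  under eq_bigr => i _ do rewrite ffunE -kA.
  rewrite -(big_morph (mul^~ k) kD (quasifield_mul0 HQ k)).
  by move/(quasifield_mulIr HQ k0); apply: miss.
have cardV : #|{: {ffun 'I_d -> Q} * Q}| = (#|Q| * #|Q| ^ d)%N.
  by rewrite card_prod card_ffun card_ord mulnC.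
have qm : (#|Q| * #|Q| ^ d.-1 = #|Q| ^ d)%N by rewrite -expnS prednK.
have := no_edge_bound deg codeg qm cardV noST.
rewrite cardT -cardKs [(2 * d)%N]mulnC expnM -cardS.
(* Both sides carry a spare factor |S|, which can be cancelled unless [S] is empty. *)
have [->|S_gt0] := posnP #|S|; first by rewrite muln0.
by move=> ?; rewrite addnC expnD -(leq_pmul2r S_gt0) mulnAC -[leqRHS]mulnA.
Qed.

(** * Passage to real exponents *)

Theorem theorem1p15 (R : realType) (Q : finType) (add mul : Q -> Q -> Q)
    (zero : Q) (HQ : is_left_quasifield add mul zero)
    (d : nat) (Hd : (1 <= d)%N) (A : {set Q})
    (HA : (#|Q|%:R : R) `^ (1 / 2 + 1 / d%:R)
            * (#|qkernel add mul|%:R - 1) `^ (- (1 / (2 * d%:R)))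
          < #|A|%:R) :
  forall x : Q, x <> zero ->
    exists a a' : 'I_d -> Q,
      (forall i, a i \in A /\ a' i \in A) /\
      x = \big[add/zero]_(i < d) mul (a i) (a' i).
Proof.
move=> x x0; apply: contrapT => no_sol.
suff : (#|Q| ^ (d + 2) < (#|qkernel add mul| - 1) * #|A| ^ (2 * d))%N.
  rewrite ltnNge (missed_dot_product_bound HQ Hd x0) // => u v uA vA uv.
  by apply: no_sol; exists u, v; split=> // i; split.
rewrite -(ltr_nat R) natrM !natrX.
have K_gt1 := qkernel_gt1 HQ; rewrite natrB ?(ltnW K_gt1) //.
move: HA; set K : R := #|qkernel add mul|%:R - 1.
set q : R := #|Q|%:R; set a : R := #|A|%:R => HA.
have K_gt0 : 0 < K by rewrite subr_gt0 ltr1n.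
have q_ge0 : 0 <= q by rewrite ler0n.
have d0 : d%:R != 0 :> R by rewrite pnatr_eq0 -lt0n.
(* Raising the size hypothesis to the power 2d turns the exponents into the integers d + 2 and
   -1. *)
have e1 : (1 / 2 + 1 / d%:R) * (2 * d)%:R = (d + 2)%:R :> R.
  by rewrite natrM natrD; field.
have e2 : - (1 / (2 * d%:R)) * (2 * d)%:R = - 1 :> R by rewrite natrM; field.
rewrite -(ltr_pXn2r (n := 2 * d)) ?muln_gt0 ?nnegrE ?mulr_ge0 ?powR_ge0 // in HA.
rewrite exprMn -powR_mulrn ?powR_ge0 // -powR_mulrn ?powR_ge0 // in HA.
rewrite -!powRrM e1 e2 in HA.
rewrite powR_inv1 ?(ltW K_gt0) // ltr_pdivrMr // powR_mulrn // in HA.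
by rewrite mulrC.
Qed.
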